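(* Let $\star$ be a semistar operation on an integral domain $D$ with quotient field $K$, let $X$ be an indeterminate over $K$, and let $[\widetilde\star]$, $\langle\widetilde\star\rangle$, $(\widetilde\star)$ be the semistar operations on $D[X]$ defined, for $A\in\overline{\boldsymbol F}(D[X])$ and with $Q$ ranging over $\mathrm{QMax}^{\star_f}(D)$, by $$A^{[\widetilde\star]}:=\bigcap_Q AD_Q[X],\qquad A^{(\widetilde\star)}:=\bigcap_Q AD_Q(X),\qquad A^{\langle\widetilde\star\rangle}:=A^{(\widetilde\star)}\cap AK[X].$$ Assume that $D_Q\subsetneq K$ for some $Q\in\mathrm{QMax}^{\star_f}(D)$. (1) $[\widetilde\star]$, $\langle\widetilde\star\rangle$, and $(\widetilde\star)$ (respectively, $[\widetilde\star]$ and $\langle\widetilde\star\rangle$) are distinct finite type stable semistar extensions to $D[X]$ (respectively, distinct finite type stable semistar strict extensions) of $\widetilde\star$. Moreover, $(\widetilde\star)$ is the unique finite type stable semistar extension to $D[X]$ of $\widetilde\star$ defined by an extended saturated multiplicative set of $D[X]$ (i.e., of the form $\circledast_{\mathcal S}$ with $\mathcal S$ an extended saturated multiplicative set of $D[X]$); namely, $(\widetilde\star)=\circledast_{\mathcal S(\star)}$, where $\mathcal S(\star)=\mathcal N^\star:=\{0\ne g\in D[X]\mid\boldsymbol c_D(g)^\star=D^\star\}$. (2) $[\widetilde\star]\sim\langle\widetilde\star\rangle\sim(\widetilde\star)$ and, moreover, $[\widetilde\star]\approx\langle\widetilde\star\rangle$, but neither $[\widetilde\star]$ nor $\langle\widetilde\star\rangle$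 is strictly equivalent over $D$ to $(\widetilde\star)$.
   Context: For an integral domain $R$ with quotient field $L$: $\overline{\boldsymbol F}(R)$ is the set of nonzero $R$-submodules of $L$ and $\boldsymbol f(R)$ the set of nonzero finitely generated ones. A semistar operation on $R$ is a map $\star:\overline{\boldsymbol F}(R)\to\overline{\boldsymbol F}(R)$, $E\mapsto E^\star$, such that for all $0\ne x\in L$ and $E,F\in\overline{\boldsymbol F}(R)$: $(xE)^\star=xE^\star$; $E\subseteq F$ implies $E^\star\subseteq F^\star$; $E\subseteq E^\star=(E^\star)^\star$. $E^{\star_f}:=\bigcup\{F^\star\mid F\in\boldsymbol f(R),F\subseteq E\}$; $\star$ is of finite type if $\star=\star_f$; $\star$ is stable if $(E\cap F)^\star=E^\star\cap F^\star$ for all $E,F$. A nonzero ideal $I$ of $R$ is a quasi-$\star$-ideal if $I^\star\cap R=I$; $\mathrm{QMax}^\star(R)$ is the set of maximal elements among proper quasi-$\star$-ideals (these are prime). $\widetilde\star$ is the semistar operation $E^{\widetilde\star}:=\bigcap\{ER_P\mid P\in\mathrm{QMax}^{\star_f}(R)\}$. For a ring $T$, $T(X):=\{f/g\mid f,g\in T[X],\ \boldsymbol c(g)=T\}$ is its Nagata ring; $\boldsymbol c_D(g)$ is the content ideal of $g$ in $D$ (generated by the coefficients). For a multiplicative subset $\mathcal S$ of $D[X]$ (containing $1$, not containing $0$, multiplicatively closed), $\mathcal S^\sharp:=D[X]\setminus\bigcup\{P[X]\mid P\in\mathrm{Spec}(D),\ P[X]\cap\mathcal S=\emptyset\}$;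 $\mathcal S$ is extended saturated if $\mathcal S=\mathcal S^\sharp$. $\circledast_{\mathcal S}$ is the semistar operation $A\mapsto A\,D[X]_{\mathcal S}$ on $D[X]$. For $E\in\overline{\boldsymbol F}(D)$, $E[X]=E\,D[X]$. A semistar operation $\circledast$ on $D[X]$ is an extension (respectively, a strict extension) of a semistar operation $\star'$ on $D$ if $E^{\star'}=(E[X])^\circledast\cap K$ (respectively, $E^{\star'}[X]=(E[X])^\circledast$) for all $E\in\overline{\boldsymbol F}(D)$. Two semistar operations $\circledast',\circledast''$ on $D[X]$ are equivalent over $D$, $\circledast'\sim\circledast''$ (respectively, strictly equivalent over $D$, $\circledast'\approx\circledast''$), if $(E[X])^{\circledast'}\cap K=(E[X])^{\circledast''}\cap K$ (respectively, $(E[X])^{\circledast'}=(E[X])^{\circledast''}$) for each $E\in\overline{\boldsymbol F}(D)$. *)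

(* Defs.v *)
From HB Require Import structures.
From mathcomp Require Import all_boot all_order all_algebra.
From mathcomp Require Import boolp classical_sets.

Set Implicit Arguments.
Unset Strict Implicit.
Unset Printing Implicit Defensive.

Import GRing.Theory.
Local Notation "x %:F" := (tofrac x).
Local Open Scope classical_set_scope.
Local Open Scope ring_scope.

(* Finite sums of products a * b with a in A and b in B.  When A and B are
   submodules of a field this is the product module AB. *)
Definition prodm (L : fieldType) (A B : set L) : set L :=
  [set z | exists s : seq (L * L),
     (forall p, p \in s -> A p.1 /\ B p.2) /\ z = \sum_(p <- s) p.1 * p.2].

Section Semistar.

(* L is meant to be a quotient field of R via iota; the instances used are
   tofrac : D -> {fraction D} and polyfrac : D[X] -> K(X) (tofrac_quot and
   polyfrac_quot below).  Operations are total on [set L], but only their values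
   on [Fbar] matter: all conditions, including equality, are relative to it. *)
Context (R : idomainType) (L : fieldType) (iota : {rmorphism R -> L}).

Definition submodule (E : set L) : Prop :=
  [/\ E 0, (forall x y, E x -> E y -> E (x + y))
    & (forall a x, E x -> E (iota a * x))].

Definition Fbar : set (set L) :=
  [set E | submodule E /\ exists2 x, E x & x != 0].

Definition fgen : set (set L) :=
  [set E | Fbar E /\ exists s : seq L, E = prodm (range iota) [set` s]].

Definition scale (x : L) (E : set L) : set L := [set x * y | y in E].

Record semistar (star : set L -> set L) : Prop := Semistar {
  semistar_Fbar : forall E, Fbar E -> Fbar (star E);
  semistar_scale : forall x E, x != 0 -> Fbar E ->
    star (scale x E) = scale x (star E);
  semistar_mono : forall E F, Fbar E -> Fbar F -> E `<=` F ->
    star E `<=` star F;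
  semistar_ext : forall E, Fbar E -> E `<=` star E;
  semistar_idem : forall E, Fbar E -> star (star E) = star E
}.

Definition op_eq (star1 star2 : set L -> set L) : Prop :=
  forall E, Fbar E -> star1 E = star2 E.

Definition star_f (star : set L -> set L) (E : set L) : set L :=
  \bigcup_(F in [set F | fgen F /\ F `<=` E]) star F.

Definition finite_type (star : set L -> set L) : Prop :=
  op_eq star (star_f star).

Definition stable (star : set L -> set L) : Prop :=
  forall E F, Fbar E -> Fbar F -> star (E `&` F) = star E `&` star F.

Definition ideal (I : set R) : Prop :=
  [/\ I 0, (forall x y, I x -> I y -> I (x + y))
    & (forall a x, I x -> I (a * x))].

Definition prime_ideal (P : set R) : Prop :=
  [/\ ideal P, ~ P 1 & forall x y, P (x * y) -> P x \/ P y].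

Definition quasi_ideal (star : set L -> set L) (I : set R) : Prop :=
  [/\ ideal I, (exists2 x, I x & x != 0)
    & iota @^-1` (star (iota @` I)) = I].

Definition QMax (star : set L -> set L) : set (set R) :=
  [set Q | [/\ quasi_ideal star Q, Q <> setT
    & forall J, quasi_ideal star J -> J <> setT -> Q `<=` J -> J = Q]].

Definition loc (S : set R) : set L :=
  [set z | exists a s, S s /\ z = iota a / iota s].

Definition loc_at (P : set R) : set L := loc (~` P).

Definition star_tilde (star : set L -> set L) (E : set L) : set L :=
  \bigcap_(P in QMax (star_f star)) prodm E (loc_at P).

Definition multiplicative (S : set R) : Prop :=
  [/\ S 1, ~ S 0 & forall x y, S x -> S y -> S (x * y)].

Definition circledast (S : set R) (A : set L) : set L := prodm A (loc S).

End Semistar.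

Lemma tofrac_quot (R : idomainType) (z : {fraction R}) :
  exists p q : R, q != 0 /\ z = p%:F / q%:F.
Proof.
elim/quotW: z => x; exists \n_x, \d_x; split; first exact: denom_ratioP.
apply: (canRL (mulfK _)); first by rewrite tofrac_eq0 denom_ratioP.
unlock tofrac; rewrite -[LHS]FracField.pi_mul.
apply/eqmodP; rewrite /= FracField.equivfE /FracField.mulf.
by rewrite !numden_Ratio ?mulf_neq0 ?oner_eq0 ?denom_ratioP // !mulr1 mulrC.
Qed.

Section Polynomials.

Context (D : idomainType).

Local Notation K := {fraction D}.
Local Notation KX := {fraction {poly {fraction D}}}.

Definition polyfrac : {poly D} -> KX :=
  @tofrac {poly K} \o map_poly (@tofrac D).

HB.instance Definition _ := GRing.RMorphism.copy polyfrac
  (@tofrac {poly K} \o map_poly (@tofrac D)).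

Lemma clear_denom (p : {poly K}) : exists (d : D) (q : {poly D}),
  d != 0 /\ d%:F *: p = map_poly (@tofrac D) q.
Proof.
elim/poly_ind: p => [|p c [d [q [d0 dq]]]].
  by exists 1, 0; rewrite oner_eq0 scaler0 rmorph0.
have [a [b [b0 ->]]] := tofrac_quot c.
exists (d * b), ((b *: q) * 'X + (d * a)%:P); split; first by rewrite mulf_neq0.
have -> : map_poly (@tofrac D) (b *: q * 'X + (d * a)%:P)
    = (b%:F * d%:F) *: p * 'X + (d * a)%:F%:P.
  by rewrite rmorphD /= rmorphM /= map_polyX map_polyC /= map_polyZ -dq scalerA.
rewrite !tofracM scalerDr -scalerAl [b%:F * _]mulrC; congr (_ + _).
by rewrite -mul_polyC -polyCM -mulrA [b%:F * _]mulrC divfK ?tofrac_eq0.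
Qed.

Lemma polyfrac_quot (z : KX) :
  exists p q : {poly D}, q != 0 /\ z = polyfrac p / polyfrac q.
Proof.
have [f [g [g0 ->]]] := tofrac_quot z.
have [d [p [d0 dp]]] := clear_denom f; have [e [q [e0 eg]]] := clear_denom g.
have dF : d%:F != 0 :> K by rewrite tofrac_eq0.
have eF : e%:F != 0 :> K by rewrite tofrac_eq0.
have q0 : q != 0.
  apply/eqP => q0; move/eqP: eg; rewrite q0 rmorph0 scaler_eq0.
  by rewrite (negPf eF) (negPf g0).
exists (e *: p), (d *: q); split; first by rewrite -mul_polyC mulf_neq0 ?polyC_eq0.
rewrite /polyfrac /= !map_polyZ /= -dp -eg !scalerA [d%:F * _]mulrC.
rewrite -!mul_polyC ![(_ * f)%:F]tofracM ![(_ * g)%:F]tofracM.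
by rewrite -mulf_div divff ?mul1r // tofrac_eq0 polyC_eq0 mulf_neq0.
Qed.

Definition constfrac : K -> KX := @tofrac {poly K} \o polyC.

(* T[X], as a subset of K(X), for T a subset of K. *)
Definition polys (T : set K) : set KX :=
  [set tofrac f | f in [set f : {poly K} | forall i, T f`_i]].

(* The ideal of T generated by the coefficients of g, for T a subring of K and
   g in T[X]. *)
Definition content (T : set K) (g : {poly K}) : set K :=
  prodm T (range (fun i => g`_i)).

(* T(X), as a subset of K(X), for T a subring of K. *)
Definition nagata (T : set K) : set KX :=
  [set z | exists f g : {poly K},
     [/\ forall i, T f`_i, forall i, T g`_i, content T g = T
       & z = tofrac f / tofrac g]].

Definition extX (E : set K) : set KX := prodm (constfrac @` E) (range polyfrac).

Definition is_extension (star : set K -> set K) (o : set KX -> set KX) :=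
  forall E, Fbar (@tofrac D) E ->
    star E = constfrac @^-1` (o (extX E)).

Definition is_strict_extension (star : set K -> set K) (o : set KX -> set KX) :=
  forall E, Fbar (@tofrac D) E -> extX (star E) = o (extX E).

Definition equiv_over (o1 o2 : set KX -> set KX) : Prop :=
  forall E, Fbar (@tofrac D) E ->
    constfrac @^-1` (o1 (extX E)) = constfrac @^-1` (o2 (extX E)).

Definition strict_equiv_over (o1 o2 : set KX -> set KX) : Prop :=
  forall E, Fbar (@tofrac D) E -> o1 (extX E) = o2 (extX E).

Definition sharp (S : set {poly D}) : set {poly D} :=
  ~` \bigcup_(P in [set P : set D | prime_ideal P /\
                     [set p : {poly D} | forall i, P p`_i] `&` S = set0])
       [set p : {poly D} | forall i, P p`_i].

Definition extended_saturated (S : set {poly D}) : Prop :=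
  multiplicative S /\ S = sharp S.

(* D and the content ideal c_D(g) are taken inside K, where star acts. *)
Definition Nstar (star : set K -> set K) : set {poly D} :=
  [set g | g != 0 /\
     star (content (range (@tofrac D)) (map_poly (@tofrac D) g))
     = star (range (@tofrac D))].

Definition QMaxf (star : set K -> set K) : set (set D) :=
  QMax (@tofrac D) (star_f (@tofrac D) star).

Definition locD (Q : set D) : set K := loc_at (@tofrac D) Q.

(* The operations written [star~], (star~) and <star~> on D[X]. *)
Definition bracket_op (star : set K -> set K) (A : set KX) : set KX :=
  \bigcap_(Q in QMaxf star) prodm A (polys (locD Q)).

Definition paren_op (star : set K -> set K) (A : set KX) : set KX :=
  \bigcap_(Q in QMaxf star) prodm A (nagata (locD Q)).

Definition angle_op (star : set K -> set K) (A : set KX) : set KX :=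
  paren_op star A `&` prodm A (polys setT).

End Polynomials.

(* Main.v *)
(* Each of the three operations has the form A |-> the meet of localizations
   A_S, S ranging over a family of multiplicative sets of D[X]: the constants
   outside Q for [star~], the complements D[X] \ Q[X] for (star~), and the
   latter together with the nonzero constants for <star~>. Such a meet is always
   semistar and stable, and it is of finite type when every ideal meeting all S
   contains finitely many elements meeting all S; this compactness comes from
   that of QMax^{star_f}(D), i.e. from Zorn's lemma and the finite type of
   star_f. Strictness for <star~> rests on the content argument: if g f lies in
   E[X] and g is not in Q[X], then f lies in E D_Q[X]. The operations are
   separated by A = (q, X) with 0 <> q in Q, and by 1/X. Finally, evaluating an
   extension of star~ given by S at the extensions I[X] of the ideals I of D
   shows which primes P satisfy P[X] disjoint from S, and hence determines S. *)

Require Import Defs.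
From mathcomp Require Import all_boot all_order all_algebra fingroup perm.
From mathcomp Require Import boolp classical_sets.

Set Implicit Arguments.
Unset Strict Implicit.
Unset Printing Implicit Defensive.

Import GRing.Theory Defs.
Local Notation "x %:F" := (tofrac x).
Local Open Scope classical_set_scope.
Local Open Scope ring_scope.

(** * Products of submodules of a field *)

Section ProductModule.

Variable L : fieldType.
Implicit Types A B C : set L.

Lemma prodm_mul A B a b : A a -> B b -> prodm A B (a * b).
Proof.
move=> Aa Bb; exists [:: (a, b)]; split; last by rewrite big_seq1.
by move=> p; rewrite inE => /eqP->.
Qed.

(** The induction principle for finite sums of products, used for almost every inclusion of a
    product module below. *)
Lemma prodm_min A B C : C 0 -> (forall x y, C x -> C y -> C (x + y)) ->
  (forall a b, A a -> B b -> C (a * b)) -> prodm A B `<=` C.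
Proof.
move=> C0 CD CM _ [s [sAB ->]]; rewrite big_seq.
by elim/big_ind: _ => // p /sAB[]; apply: CM.
Qed.

Lemma prodm0 A B : prodm A B 0.
Proof. by exists [::]; split=> //; rewrite big_nil. Qed.

Lemma prodmD A B x y : prodm A B x -> prodm A B y -> prodm A B (x + y).
Proof.
move=> [s [sAB ->]] [t [tAB ->]]; exists (s ++ t); split; last by rewrite big_cat.
by move=> p; rewrite mem_cat => /orP[/sAB|/tAB].
Qed.

Lemma prodm_mono A A' B B' : A `<=` A' -> B `<=` B' -> prodm A B `<=` prodm A' B'.
Proof. by move=> AA' BB' _ [s [sAB ->]]; exists s; split=> // p /sAB[/AA'? /BB']. Qed.

End ProductModule.

(** * Meets of localizations *)

Section Semistar.

Variables (R : idomainType) (L : fieldType) (iota : {rmorphism R -> L}).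
Implicit Types (E F : set L) (I J Q : set R).

Local Notation gen s := (prodm (range iota) [set` s]).

Lemma prodm_submodule (B : set L) : submodule iota (prodm (range iota) B).
Proof.
split; [exact: prodm0|by move=> ? ?; apply: prodmD|].
move=> a x; move: x; apply: prodm_min.
- by rewrite mulr0; apply: prodm0.
- by move=> x y; rewrite mulrDr; apply: prodmD.
- by move=> _ b [c _ <-] Bb; rewrite mulrA -rmorphM; apply: prodm_mul => //.
Qed.

Lemma sub_prodm (B : set L) : B `<=` prodm (range iota) B.
Proof.
by move=> b Bb; rewrite -[b]mul1r; apply: prodm_mul => //; exists 1; rewrite ?rmorph1.
Qed.

Lemma prodm_sub (B : set L) E : submodule iota E -> B `<=` E ->
  prodm (range iota) B `<=` E.
Proof.
by move=> [E0 ED EM] BE; apply: prodm_min => // _ b [a _ <-] /BE; apply: EM.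
Qed.

Lemma submodule_sum E (I : Type) (r : seq I) (P : pred I) (f : I -> L) :
  submodule iota E -> (forall i, P i -> E (f i)) -> E (\sum_(i <- r | P i) f i).
Proof. by move=> [E0 ED _] Ef; elim/big_ind: _. Qed.

Lemma Fbar_prodm (B : set L) x : B x -> x != 0 -> Fbar iota (prodm (range iota) B).
Proof.
by move=> Bx x0; split; [apply: prodm_submodule|exists x => //; apply: sub_prodm].
Qed.

(** If every listed generator vanished, the module would be zero. Finite generation can thus be
    handled throughout by finite lists with a nonzero entry. *)
Lemma fgenP F :
  fgen iota F <-> exists s : seq L, [/\ F = gen s & exists2 x, x \in s & x != 0].
Proof.
split=> [[[_ [x Fx x0]] [s Fs]]|[s [-> [x xs x0]]]]; last first.
  by split; [apply: (@Fbar_prodm _ x)|exists s].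
exists s; split=> //; apply: contrapT => s0.
suff: gen s `<=` [set 0] by rewrite -Fs => /(_ x Fx) /= x00; rewrite x00 eqxx in x0.
apply: prodm_sub.
  by split=> [//|_ _ -> ->|a _ ->] /=; rewrite ?addr0 ?mulr0.
by move=> y ys /=; apply/eqP; apply: contrapT => /negP y0; apply: s0; exists y.
Qed.

Lemma scale_prodm x (B : set L) :
  scale x (prodm (range iota) B) = prodm (range iota) (scale x B).
Proof.
apply/seteqP; split=> [_ [y yB <-]|].
  move: y yB; apply: prodm_min; first by rewrite mulr0; apply: prodm0.
    by move=> y z; rewrite mulrDr; apply: prodmD.
  by move=> a b ra Bb; rewrite mulrCA; apply: prodm_mul => //; exists b.
apply: prodm_min; first by exists 0; rewrite ?mulr0 //; apply: prodm0.
  by move=> _ _ [y By <-] [z Bz <-]; exists (y + z); rewrite ?mulrDr //; apply: prodmD.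
by move=> a _ ra [b Bb <-]; exists (a * b); [apply: prodm_mul|exact: mulrCA].
Qed.

Lemma submodule_scale x E : submodule iota E -> submodule iota (scale x E).
Proof.
move=> [E0 ED EM]; split; first by exists 0; rewrite ?mulr0.
  by move=> _ _ [y Ey <-] [z Ez <-]; exists (y + z); rewrite ?mulrDr //; apply: ED.
by move=> a _ [y Ey <-]; exists (iota a * y); [apply: EM|exact: mulrCA].
Qed.

Lemma submoduleI E F :
  submodule iota E -> submodule iota F -> submodule iota (E `&` F).
Proof.
move=> [E0 ED EM] [F0 FD FM]; split=> [//|x y [Ex Fx] [Ey Fy]|a x [Ex Fx]].
  by split; [apply: ED|apply: FD].
by split; [apply: EM|apply: FM].
Qed.

(** This is the conductor of [z] into [E]. It meets [S] exactly when [z] lies in the localization of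
    [E] at [S], which turns questions about elements of a meet of localizations into questions about
    ideals of [R]. *)
Lemma submodule_colon E z : submodule iota E -> ideal [set r | E (iota r * z)].
Proof.
move=> [E0 ED EM]; split=> /= [|x y Ex Ey|a x Ex]; rewrite ?rmorph0 ?mul0r //.
  by rewrite rmorphD mulrDl; apply: ED.
by rewrite rmorphM -mulrA; apply: EM.
Qed.

Lemma ideal_image I : ideal I -> submodule iota (iota @` I).
Proof.
move=> [I0 ID IM]; split; first by exists 0; rewrite ?rmorph0.
  by move=> _ _ [x Ix <-] [y Iy <-]; exists (x + y); rewrite ?rmorphD //; apply: ID.
by move=> a _ [x Ix <-]; exists (a * x); rewrite ?rmorphM //; apply: IM.
Qed.

(** The intersection of the localizations of [E] at the members of [T], phrased with multipliers
    instead of fractions. *)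
Definition meet_loc (T : set (set R)) E : set L :=
  [set z | forall S, T S -> exists2 t, S t & E (iota t * z)].

Definition meets (T : set (set R)) J : Prop :=
  forall S, T S -> exists2 t, S t & J t.

Definition compact_family (T : set (set R)) : Prop :=
  forall J, ideal J -> meets T J ->
  exists2 s : seq R, {in s, forall r, J r} & meets T [set` s].

Section MeetLoc.

Variables (T : set (set R)) (o : set L -> set L).
Hypothesis mulT : forall S, T S -> multiplicative S.
Hypothesis oE : forall E, submodule iota E -> o E = meet_loc T E.

Lemma meet_loc_submodule E : submodule iota E -> submodule iota (meet_loc T E).
Proof.
move=> [E0 ED EM]; split=> [S /mulT[S1 _ _]|x y Tx Ty S TS|a x Tx S TS].
- by exists 1; rewrite ?mulr0.
- have [t St Ex] := Tx _ TS; have [u Su Ey] := Ty _ TS.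
  have [_ _ SM] := mulT TS; exists (t * u); first exact: SM.
  rewrite mulrDr; apply: ED; rewrite rmorphM; last by rewrite -mulrA; apply: EM.
  by rewrite mulrAC mulrC; apply: EM.
- by have [t St Ex] := Tx _ TS; exists t => //; rewrite mulrCA; apply: EM.
Qed.

Lemma meet_loc_ext E : E `<=` meet_loc T E.
Proof. by move=> x Ex S /mulT[S1 _ _]; exists 1; rewrite ?rmorph1 ?mul1r. Qed.

Lemma meet_loc_mono E F : E `<=` F -> meet_loc T E `<=` meet_loc T F.
Proof. by move=> EF z Ez S /Ez[t St /EF]; exists t. Qed.

(** Idempotence holds because two successive multipliers from [S] multiply to one multiplier in [S].
    The operation [o] is tied to [meet_loc T] on submodules only, since the intended operations are
    given by product modules. *)
Lemma meet_loc_semistar : semistar iota o.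
Proof.
split=> [E|x E x0|E F|E|E].
- move=> [sE [x Ex x0]]; rewrite oE //; split; first exact: meet_loc_submodule.
  by exists x => //; apply: meet_loc_ext.
- move=> [sE _]; rewrite !oE //; last exact: submodule_scale.
  apply/seteqP; split=> [z Tz|_ [z Tz <-] S /Tz[t St Et]].
    exists (x^-1 * z); last by rewrite mulrA divff ?mul1r.
    move=> S /Tz[t St [e Ee xe]]; exists t => //.
    by rewrite mulrCA -xe mulrA mulVf ?mul1r.
  by exists t => //; exists (iota t * z) => //; rewrite mulrCA.
- by move=> [sE _] [sF _] EF; rewrite !oE //; apply: meet_loc_mono.
- by move=> [sE _]; rewrite oE //; apply: meet_loc_ext.
- move=> [sE _]; rewrite !oE //; last exact: meet_loc_submodule.
  apply/seteqP; split=> [z Tz S TS|]; last exact: meet_loc_ext.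
  have [t St Tt] := Tz _ TS; have [u Su Eu] := Tt _ TS.
  by exists (u * t); [have [_ _] := mulT TS; apply|rewrite rmorphM -mulrA].
Qed.

(** The product of a multiplier into [E] and a multiplier into [F] serves for both. *)
Lemma meet_loc_stable : stable iota o.
Proof.
move=> E F [sE _] [sF _]; rewrite !oE //; last exact: submoduleI.
apply/seteqP; split=> [z Tz|z [Ez Fz] S TS].
  by split=> S /Tz[t St [Et Ft]]; exists t.
have [t St Et] := Ez _ TS; have [u Su Fu] := Fz _ TS.
exists (t * u); first by have [_ _] := mulT TS; apply.
rewrite rmorphM; split; last by rewrite -mulrA; case: sF => _ _; apply.
by rewrite mulrAC mulrC; case: sE => _ _; apply.
Qed.

(** Compactness, applied to the conductor of [z] into [E], yields finitely many multipliers; the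
    multiples of [z] by them generate a submodule of [E] all of whose localizations contain [z]. *)
Lemma meet_loc_finite_type : compact_family T -> finite_type iota o.
Proof.
move=> cT E [sE [x Ex x0]]; rewrite oE //; apply/seteqP; split=> [z Tz|z].
  have [s sJ Ts] := cT _ (submodule_colon z sE) Tz.
  (* The nonzero [x] keeps the generated module nonzero even when [z] is 0. *)
  pose t := x :: [seq iota r * z | r <- s].
  have tE : [set` t] `<=` E.
    by move=> y /=; rewrite inE => /orP[/eqP->//|/mapP[r rs ->]]; apply: sJ.
  exists (gen t).
    by split; [apply/fgenP; exists t; split=> //; exists x; rewrite ?mem_head
      |apply: prodm_sub].
  rewrite oE => [S /Ts[r Sr rs]|]; last exact: prodm_submodule.
  exists r => //; apply: sub_prodm; rewrite /= inE; apply/orP; right.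
  by apply/mapP; exists r.
move=> [F [[[sF _] _] FE]]; rewrite oE //; exact: meet_loc_mono.
Qed.

End MeetLoc.

(* A B is the localization A_S as soon as B is squeezed between the inverses
   of S and the fractions with denominator in S. *)
Lemma prodm_locE (S : set R) E B : multiplicative S -> submodule iota E ->
  (forall t, S t -> B (iota t)^-1 /\ iota t != 0) ->
  (forall b, B b -> exists2 t, S t & range iota (iota t * b)) ->
  prodm E B = [set z | exists2 t, S t & E (iota t * z)].
Proof.
move=> [S1 _ SM] [E0 ED EM] SB BS; apply/seteqP; split=> [|z [t /SB[Bt t0] Et]].
  apply: prodm_min; first by exists 1; rewrite ?mulr0.
    move=> x y [t St Ex] [u Su Ey]; exists (t * u); first exact: SM.
    rewrite mulrDr; apply: ED; rewrite rmorphM; last by rewrite -mulrA; apply: EM.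
    by rewrite mulrAC mulrC; apply: EM.
  move=> e b Ee /BS[t St [r _ rE]]; exists t => //.
  by rewrite mulrCA -rE mulrC; apply: EM.
by rewrite -[z](mulKf t0) mulrC; apply: prodm_mul.
Qed.

Lemma prodm_loc (S : set R) E : injective iota -> multiplicative S ->
  submodule iota E ->
  prodm E (loc iota S) = [set z | exists2 t, S t & E (iota t * z)].
Proof.
move=> inj mS sE; have S0 t : S t -> iota t != 0.
  case: mS => _ S0 _ St; rewrite -(rmorph0 iota) (inj_eq inj).
  by apply/eqP => t0; apply: S0; rewrite -t0.
apply: prodm_locE => // [t St|b [a [t [St ->]]]].
  by split; [exists 1, t; rewrite rmorph1 mul1r|apply: S0].
by exists t => //; exists a => //; rewrite mulrC divfK ?S0.
Qed.

Lemma prime_multiplicative Q : prime_ideal Q -> multiplicative (~` Q).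
Proof.
move=> [[Q0 _ _] Q1 QM]; split=> //.
by move=> x y Qx Qy /QM[].
Qed.

End Semistar.

(** * Maximal quasi-ideals *)

Section MaximalQuasiIdeals.

Variables (R : idomainType) (L : fieldType) (iota : {rmorphism R -> L}).
Hypothesis iota_inj : injective iota.
Variable star : set L -> set L.
Hypothesis hstar : semistar iota star.
Implicit Types (E F : set L) (I J Q : set R).

Local Notation gen s := (prodm (range iota) [set` s]).
Local Notation sf := (star_f iota star).

Lemma star_fP E z : submodule iota E ->
  sf E z <-> exists s : seq L,
    [/\ [set` s] `<=` E, exists2 x, x \in s & x != 0 & star (gen s) z].
Proof.
move=> sE; split=> [[F [/fgenP[s [-> s0]] sub] Fz]|[s [sub s0 sz]]].
  by exists s; split=> //; apply: subset_trans sub; apply: sub_prodm.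
exists (gen s) => //; split; last exact: prodm_sub.
by apply/fgenP; exists s.
Qed.

Lemma star_f_mono E F : E `<=` F -> sf E `<=` sf F.
Proof. by move=> EF z [G [fG /subset_trans/(_ EF) GF] Gz]; exists G. Qed.

Lemma Fbar_gen (s : seq L) : (exists2 x, x \in s & x != 0) -> Fbar iota (gen s).
Proof. by move=> [x xs x0]; apply: (@Fbar_prodm _ _ _ _ x). Qed.

Lemma star_genS (s t : seq L) : (exists2 x, x \in s & x != 0) ->
  {subset s <= t} -> star (gen s) `<=` star (gen t).
Proof.
move=> [x xs x0] st; apply: (semistar_mono hstar).
- by apply: Fbar_gen; exists x.
- by apply: Fbar_gen; exists x => //; apply: st.
- exact: prodm_mono.
Qed.

Lemma star_gen_submodule (s : seq L) : (exists2 x, x \in s & x != 0) ->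
  submodule iota (star (gen s)).
Proof. by move=> /Fbar_gen/(semistar_Fbar hstar)[]. Qed.

Lemma star_f_ext E : Fbar iota E -> E `<=` sf E.
Proof.
(* The list must have a nonzero entry, and [z] may be 0; hence the companion [x]. *)
move=> [sE [x Ex x0]] z Ez; apply/star_fP => //; exists [:: z; x].
have h : exists2 y, y \in [:: z; x] & y != 0 by exists x; rewrite ?inE ?eqxx ?orbT.
split=> //; first by move=> y /=; rewrite !inE => /orP[]/eqP->.
apply: (semistar_ext hstar (Fbar_gen h)).
by apply: sub_prodm; rewrite /= inE eqxx.
Qed.

(** The union defining [star_f] is directed: two finite lists both embed in their concatenation. *)
Lemma star_f_submodule E : Fbar iota E -> submodule iota (sf E).
Proof.
move=> bE; have [sE [x Ex x0]] := bE; split.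
- by apply: star_f_ext => //; case: sE.
- move=> y z /(star_fP _ sE)[s [sub s0 sy]] /(star_fP _ sE)[t [tub t0 tz]].
  have st0 : exists2 x, x \in s ++ t & x != 0.
    by case: s0 => u us u0; exists u; rewrite ?mem_cat ?us.
  apply/star_fP => //; exists (s ++ t); split=> //.
    by move=> u /=; rewrite mem_cat => /orP[/sub|/tub].
  have [_ sD _] := star_gen_submodule st0; apply: sD.
    by apply: star_genS sy => // u us; rewrite mem_cat us.
  by apply: star_genS tz => // u us; rewrite mem_cat us orbT.
- move=> a z /(star_fP _ sE)[s [sub s0 sz]]; apply/star_fP => //; exists s.
  by split=> //; have [_ _] := star_gen_submodule s0; apply.
Qed.

(** Finitely many elements of [sf E] already lie in the [star] of one finitely generated submodule
    of [E]; idempotence of [star] on that submodule then suffices. *)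
Lemma star_f_idem E : Fbar iota E -> sf (sf E) `<=` sf E.
Proof.
move=> bE; have [sE [x Ex x0]] := bE; have sfE := star_f_submodule bE.
have common (s : seq L) : [set` s] `<=` sf E -> exists t : seq L,
    [/\ [set` t] `<=` E, exists2 x, x \in t & x != 0 & [set` s] `<=` star (gen t)].
  elim: s => [_|y s IH sub].
    exists [:: x]; split=> //; last by exists x; rewrite ?inE.
    by move=> u /=; rewrite inE => /eqP->.
  have [|t [tE t0 st]] := IH.
    by move=> u us; apply: sub; rewrite /= inE us orbT.
  have /(star_fP _ sE)[v [vE v0 vy]] : sf E y by apply: sub; rewrite /= inE eqxx.
  exists (v ++ t); split; first by move=> u /=; rewrite mem_cat => /orP[/vE|/tE].
    by case: v0 => u us u0; exists u; rewrite ?mem_cat ?us.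
  move=> u /=; rewrite inE => /orP[/eqP->|/st].
    by apply: star_genS vy => // w wv; rewrite mem_cat wv.
  by apply: star_genS => // w wv; rewrite mem_cat wv orbT.
move=> z /(star_fP _ sfE)[s [/common[t [tE t0 st]] s0 sz]].
apply/star_fP => //; exists t; split=> //; have bt := Fbar_gen t0.
rewrite -(semistar_idem hstar bt); apply: (semistar_mono hstar) sz.
- exact: Fbar_gen.
- exact: semistar_Fbar.
- by apply: prodm_sub => //; apply: star_gen_submodule.
Qed.

Lemma Fbar_image I : ideal I -> (exists2 x, I x & x != 0) -> Fbar iota (iota @` I).
Proof.
move=> /(@ideal_image _ _ iota) sI [x Ix x0]; split=> //; exists (iota x).
  by exists x.
by rewrite -(rmorph0 iota) (inj_eq iota_inj).
Qed.

Lemma sub_image_seq (s : seq L) I : [set` s] `<=` iota @` I ->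
  exists2 u : seq R, [set` u] `<=` I & s = map iota u.
Proof.
elim: s => [_|y s IH sI]; first by exists [::].
have [|u uI ->] := IH; first by move=> z zs; apply: sI; rewrite /= inE zs orbT.
have /sI[v Iv <-] : [set` y :: s] y by rewrite /= inE eqxx.
by exists (v :: u) => // w /=; rewrite inE => /orP[/eqP->|/uI].
Qed.

(** The quasi-closure of [I], which turns the ideal produced by Zorn's lemma into a quasi-ideal. *)
Let clos I := iota @^-1` (sf (iota @` I)).

Lemma sub_clos I : ideal I -> (exists2 x, I x & x != 0) -> I `<=` clos I.
Proof. by move=> iI I0 x Ix; apply: star_f_ext; [apply: Fbar_image|exists x]. Qed.

(** The image of [clos I] lies in the closure of the image of [I], so idempotence of [sf] shows that
    a second contraction adds nothing. *)
Lemma quasi_clos I : ideal I -> (exists2 x, I x & x != 0) ->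
  quasi_ideal iota sf (clos I).
Proof.
move=> iI I0; have bI := Fbar_image iI I0.
have [s0 sD sM] := star_f_submodule bI; split.
- rewrite /clos; split=> [|x y|a x] /=; rewrite ?rmorph0 ?rmorphD ?rmorphM //.
    exact: sD.
  exact: sM.
- by case: I0 => x Ix x0; exists x => //; apply: sub_clos => //; exists x.
- apply/seteqP; split=> x /=.
    move=> h; apply: (star_f_idem bI); move: h; apply: star_f_mono.
    by move=> _ [y cy <-].
  by apply: star_f_mono => _ [y Iy <-]; exists y => //; apply: sub_clos.
Qed.

Lemma quasi_idealT I : ideal I -> I <> setT <-> ~ I 1.
Proof.
move=> [_ _ IM]; split=> [IT I1|I1 IT]; last by apply: I1; rewrite IT.
by apply: IT; apply/seteqP; split=> // x _; rewrite -[x]mulr1; apply: IM.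
Qed.

(** By contraposition: if 1 is not in the closure, Zorn's lemma gives an ideal containing [I] that
    is maximal with this property. It coincides with its quasi-closure and is therefore a maximal
    quasi-ideal above [I]. *)
Lemma star_f1 I : ideal I -> (exists2 x, I x & x != 0) ->
  (forall Q, QMax iota sf Q -> ~ I `<=` Q) -> sf (iota @` I) 1.
Proof.
move=> iI [x Ix x0] Imax; apply: contrapT => I1.
(* The predicate looks at the union of [A] with [I], so that the empty chain, whose union is the
   empty set, is covered by [I] itself. *)
pose P A := ideal (A `|` I) /\ ~ sf (iota @` (A `|` I)) 1.
have [F FP totF|A [[iA A1] maxA]] := @Zorn_bigcup _ P.
  have [[I0 ID IM] bI] := (iI, Fbar_image iI (ex_intro2 _ _ x Ix x0)).
  pose U := \bigcup_(X in F) X `|` I.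
  (* A finite subset of the union of the chain lies in a single good ideal. Being an ideal, and
     having 1 in the closure, are both witnessed by finite subsets, so this settles the chain
     condition. *)
  have common (s : seq R) : [set` s] `<=` U -> exists2 V,
      V `<=` U & [/\ ideal V, ~ sf (iota @` V) 1, I `<=` V & [set` s] `<=` V].
    (* The induction also remembers the origin of [V], so that totality of the chain can compare it
       with the next member. *)
    move=> sU; suff [V [VU [V1 V2] V3 V4]] : exists V, [/\ V `<=` U,
        ideal V /\ ~ sf (iota @` V) 1, V = I \/ (exists2 X, F X & V = X `|` I)
        & [set` s] `<=` V].
      by exists V => //; split=> //; case: V3 => [->|[X _ ->]] // ? ?; right.
    elim: s sU => [_|y s IH sU].
      by exists I; split=> //; [move=> ? ?; right|left].
    have [|V [VU V1 V2 V3]] := IH.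
      by move=> z zs; apply: sU; rewrite /= inE zs orbT.
    have /sU : [set` y :: s] y by rewrite /= inE eqxx.
    have ext W : V `<=` W -> W y -> [set` y :: s] `<=` W.
      by move=> VW Wy z /=; rewrite inE => /orP[/eqP->|/V3/VW].
    have big X : F X -> X `|` I `<=` U.
      by move=> FX z [Xz|Iz]; [left; exists X|right].
    move=> [[X FX Xy]|Iy]; last first.
      exists V; split=> //; apply: ext => //.
      by case: V2 => [->|[X _ ->]] //; right.
    case: V2 => [VI|[Y FY VY]].
      exists (X `|` I); split=> //; [exact: big|exact: FP|by right; exists X|].
      by apply: ext; [rewrite VI => ? ?; right|left].
    case: (totF _ _ FX FY) => [XY|YX].
      exists V; split=> //; first by right; exists Y.
      by apply: ext => //; rewrite VY; left; apply: XY.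
    exists (X `|` I); split=> //; [exact: big|exact: FP|by right; exists X|].
    by apply: ext; [rewrite VY => z [/YX|]; [left|right]|left].
  have iU : ideal U.
    split=> [|a b Ua Ub|a b Ub]; first by right.
    - have [|V VU [[_ VD _] _ _ sV]] := common [:: a; b].
        by move=> z /=; rewrite !inE => /orP[]/eqP->.
      by apply: VU; apply: VD; apply: sV; rewrite /= !inE eqxx ?orbT.
    - have [|V VU [[_ _ VM] _ _ sV]] := common [:: b].
        by move=> z /=; rewrite !inE => /eqP->.
      by apply: VU; apply: VM; apply: sV; rewrite /= !inE eqxx ?orbT.
  split=> // /(star_fP _ (ideal_image _ iU))[s [sU s0 s1]].
  have [u us su] := sub_image_seq sU.
  have [V VU [iV V1 IV uV]] := common u us; apply: V1.
  apply/star_fP; first exact: ideal_image.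
  exists s; split=> // z /=; rewrite su => /mapP[w wu ->].
  by exists w => //; apply: uV.
set J := A `|` I in iA A1.
have J0 : exists2 y, J y & y != 0 by exists x => //; right.
have [cJ cJ0 cJc] := quasi_clos iA J0.
have cIE : clos J `|` I = clos J.
  apply/seteqP; split=> [z [//|Iz]|z]; last by left.
  by apply: sub_clos => //; right.
(* Maximality of [A] leaves no room for a proper quasi-ideal above [J] other than [A]; applied to
   [clos J], this gives that [A], [J] and [clos J] coincide. *)
have PJ B : quasi_ideal iota sf B -> B <> setT -> J `<=` B -> B = A.
  move=> [iB B0 Bc] BT JB; apply: contrapT => BA.
  have BI : B `|` I = B.
    by apply/seteqP; split=> [z [//|Iz]|z]; [apply: JB; right|left].
  apply: (maxA B); last first.
    rewrite /P BI; split=> // B1; apply/(quasi_idealT iB): BT.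
    by rewrite -Bc /= rmorph1.
  split; first by move=> z Az; apply: JB; left.
  by move=> AB; apply: BA; apply/seteqP; split=> // z Az; apply: JB; left.
have cJT : clos J <> setT by apply/(quasi_idealT cJ); rewrite /clos /= rmorph1.
have JA : clos J = A by apply: PJ => //; apply: sub_clos.
have AJ : A = J.
  by apply/seteqP; split=> z; [left|rewrite -JA; apply: sub_clos].
apply: (Imax A); last by rewrite AJ => z; right.
split; [by rewrite -JA; apply: quasi_clos|by rewrite -JA|].
by move=> B qB BT AB; apply: PJ => //; rewrite -AJ.
Qed.

Lemma star_f1N I Q : QMax iota sf Q -> I `<=` Q -> ~ sf (iota @` I) 1.
Proof.
move=> [[iQ _ Qc] QT _] IQ I1; have /(quasi_idealT iQ) := QT; apply.
rewrite -Qc /= rmorph1; move: I1; apply: star_f_mono => _ [y Iy <-].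
by exists y => //; apply: IQ.
Qed.

(** Let [x * y] be in [Q] and [x] outside it. By maximality no maximal quasi-ideal contains Q + Rx,
    so 1 lies in the closure of Q + Rx. Multiplying by [y] puts [y] in the closure of y(Q + Rx),
    which is inside [Q]. *)
Lemma QMax_prime Q : QMax iota sf Q -> prime_ideal Q.
Proof.
move=> mQ; have [[iQ [q Qq q0] Qc] QT maxQ] := mQ.
split=> //; first exact/quasi_idealT.
move=> x y Qxy; have [Qx|Qx] := EM (Q x); [by left|right].
have [y0|y0] := eqVneq y 0; first by rewrite y0; case: iQ.
have [Q0 QD QM] := iQ.
pose I := [set z | exists2 p, Q p & exists a, z = p + a * x].
have iI : ideal I.
  split; first by exists 0 => //; exists 0; rewrite mul0r addr0.
    move=> _ _ [p Qp [a ->]] [r Qr [b ->]]; exists (p + r); first exact: QD.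
    by exists (a + b); rewrite mulrDl addrACA.
  move=> c _ [p Qp [a ->]]; exists (c * p); first exact: QM.
  by exists (c * a); rewrite mulrDr mulrA.
have QI : Q `<=` I by move=> p Qp; exists p => //; exists 0; rewrite mul0r addr0.
have Ix : I x by exists 0 => //; exists 1; rewrite mul1r add0r.
have I0 : exists2 z, I z & z != 0 by exists q => //; apply: QI.
have /(star_fP _ (ideal_image _ iI))[s [sI s0 s1]] : sf (iota @` I) 1.
  apply: star_f1 => // P mP IP; apply: Qx.
  have [[iP P0 Pc] PT _] := mP; rewrite -(maxQ P) //; first exact: IP.
  by apply: subset_trans IP.
have yL : iota y != 0 by rewrite -(rmorph0 iota) (inj_eq iota_inj).
rewrite -Qc; apply/star_fP; first exact: ideal_image.
exists [seq iota y * z | z <- s]; split.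
- move=> _ /= /mapP[z /sI[_ [p Qp [a ->]] <-] ->]; exists (y * (p + a * x)).
    by rewrite mulrDr; apply: QD; [apply: QM|rewrite mulrCA [y * x]mulrC; apply: QM].
  exact: rmorphM.
- case: s0 => z zs z0; exists (iota y * z); last by rewrite mulf_neq0.
  by apply/mapP; exists z.
(* The closure commutes with scaling, so 1 in the closure of [s] gives [y] in the closure of the
   list multiplied by [y]. *)
- have -> : gen [seq iota y * z | z <- s] = scale (iota y) (gen s).
    rewrite scale_prodm; congr prodm; apply/seteqP; split=> z /=.
      by move=> /mapP[u us ->]; exists u.
    by move=> [u us <-]; apply/mapP; exists u.
  by rewrite (semistar_scale hstar) //; [exists 1; rewrite ?mulr1|apply: Fbar_gen].
Qed.

(** That 1 lies in the closure of [I] is witnessed by a finite list from [I]; a [Q] containing the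
    whole list would have 1 in its own closure. *)
Lemma QMax_compact I : ideal I -> (exists2 x, I x & x != 0) ->
  (forall Q, QMax iota sf Q -> ~ I `<=` Q) ->
  exists2 s : seq R, {in s, forall r, I r}
    & forall Q, QMax iota sf Q -> exists2 r, r \in s & ~ Q r.
Proof.
move=> iI I0 Imax.
have /(star_fP _ (ideal_image _ iI))[s [sI s0 s1]] := star_f1 iI I0 Imax.
have [u uI su] := sub_image_seq sI.
exists u => // Q mQ; apply: contrapT => uQ.
apply: (star_f1N mQ (@subset_refl _ Q)).
apply/star_fP; first by apply: ideal_image; case: (mQ) => -[].
exists s; split=> // y /=; rewrite su => /mapP[w wu ->]; exists w => //.
by apply: contrapT => Qw; apply: uQ; exists w.
Qed.

End MaximalQuasiIdeals.

(** * Polynomial extensions of modules *)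

Lemma tofrac_inj (R : idomainType) : injective (@tofrac R).
Proof. by move=> x y /eqP; rewrite tofrac_eq => /eqP. Qed.

Section PolynomialModules.

Variable D : idomainType.

Local Notation K := {fraction D}.
Local Notation KX := {fraction {poly {fraction D}}}.
Local Notation iK := (@tofrac D).
Local Notation iX := (@polyfrac D).
Local Notation coefsin Q := [set p : {poly D} | forall i, Q p`_i].

Implicit Types (E : set K) (A : set KX) (I Q : set D) (f : {poly K}) (g : {poly D}).

Lemma polyfrac_inj : injective iX.
Proof. by move=> p q /tofrac_inj/(map_inj_poly (@tofrac_inj D) (rmorph0 _)). Qed.

Lemma polyfracM g f : iX g * tofrac f = tofrac (map_poly iK g * f).
Proof. by rewrite rmorphM. Qed.

Lemma polyfracC (d : D) : iX d%:P = constfrac d%:F.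
Proof. by rewrite /polyfrac /= map_polyC. Qed.

Lemma polyfracCM (d : D) f : iX d%:P * tofrac f = tofrac (d%:F *: f).
Proof. by rewrite polyfracM map_polyC mul_polyC. Qed.

Lemma polysE (T : set K) f : polys T (tofrac f) <-> forall i, T f`_i.
Proof. by split=> [[h Th /tofrac_inj<-]|Tf] //; exists f. Qed.

Lemma polys_constE E z : submodule iK E -> polys E (constfrac z) <-> E z.
Proof.
move=> [E0 _ _]; split=> [/polysE/(_ 0%N)|Ez]; first by rewrite coefC.
by apply/polysE => i; rewrite coefC; case: eqP.
Qed.

Lemma polys_submodule E : submodule iK E -> submodule iX (polys E).
Proof.
move=> sE; have [E0 ED EM] := sE; split.
- by rewrite -tofrac0; apply/polysE => i; rewrite coef0.
- move=> _ _ [f Ef <-] [h Eh <-]; rewrite -rmorphD; apply/polysE => i.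
  by rewrite coefD; apply: ED.
- move=> g _ [f Ef <-]; rewrite polyfracM; apply/polysE => i.
  rewrite coefM; apply: (submodule_sum _ sE) => j _.
  by rewrite coef_map; apply: EM.
Qed.

Lemma extXE E : submodule iK E -> extX E = polys E.
Proof.
move=> sE; have [E0 ED EM] := sE; have [P0 PD PM] := polys_submodule sE.
apply/seteqP; split=> [|_ [f Ef <-]].
  apply: prodm_min => // _ _ [e Ee <-] [g _ <-]; rewrite mulrC; apply: PM.
  exact/polys_constE.
rewrite -[f]coefK poly_def rmorph_sum /=.
elim/big_ind: _ => [|x y|i _]; first exact: prodm0.
  exact: prodmD.
rewrite -mul_polyC rmorphM; apply: prodm_mul; first by exists f`_i.
by exists 'X^i => //; rewrite /polyfrac /= map_polyXn.
Qed.

Lemma Fbar_extX E : Fbar iK E -> Fbar iX (extX E).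
Proof.
move=> [sE [x Ex x0]]; rewrite extXE //; split; first exact: polys_submodule.
exists (constfrac x); first exact/polys_constE.
by rewrite /constfrac /= tofrac_eq0 polyC_eq0.
Qed.

Lemma map_poly_lift f : (forall i, range iK f`_i) -> exists g, f = map_poly iK g.
Proof.
move=> fD; have /choice[c cE] : forall i, exists a, iK a = f`_i.
  by move=> i; have [a _ aE] := fD i; exists a.
exists (\poly_(i < size f) c i); apply/polyP => i; rewrite coef_map coef_poly.
by case: ltnP => [_|le_i]; [rewrite [RHS]cE|rewrite nth_default ?rmorph0].
Qed.

(** Only the coefficients below [size f] matter, so the product of their finitely many multipliers
    works for all. *)
Lemma common_multiplier (S : set D) E f : multiplicative S -> submodule iK E ->
  (forall i, exists2 d, S d & E (iK d * f`_i)) ->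
  exists2 d, S d & forall i, E (iK d * f`_i).
Proof.
move=> [S1 _ SM] [E0 _ EM] Ef.
have [d Sd Ed] : exists2 d, S d & forall i, (i < size f)%N -> E (iK d * f`_i).
  elim: (size f) => [|n [d Sd Ed]]; first by exists 1.
  have [e Se Ee] := Ef n; exists (d * e); first exact: SM.
  move=> i; rewrite ltnS leq_eqVlt rmorphM => /orP[/eqP->|/Ed Ei].
    by rewrite -mulrA; apply: EM.
  by rewrite mulrAC mulrC; apply: EM.
exists d => // i; have [/Ed//|le_i] := ltnP i (size f).
by rewrite nth_default // mulr0.
Qed.

(** Gauss's argument: if [i] and [j] are the least indices of coefficients of [x] and [y] outside
    [Q], then the coefficient of index [i + j] of the product is the product of these two modulo
    [Q]. *)
Lemma prime_coefsin Q : prime_ideal Q -> prime_ideal (coefsin Q).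
Proof.
move=> [[Q0 QD QM] Q1 Qp].
have Qsum (n : nat) (P : pred 'I_n) (F : 'I_n -> D) :
    (forall i, P i -> Q (F i)) -> Q (\sum_(i < n | P i) F i).
  by move=> QF; elim/big_ind: _.
split.
- split=> /= [i|x y Qx Qy i|a x Qx i]; rewrite ?coef0 ?coefD ?coefM //.
    exact: QD.
  by apply: Qsum => j _; apply: QM.
- by move=> /(_ 0%N) /=; rewrite coefC.
move=> x y Qxy; apply: contrapT => /not_orP[/existsNP[i0 xi0] /existsNP[j0 yj0]].
have minidx (p : {poly D}) i : ~ Q p`_i ->
    exists2 k, ~ Q p`_k & forall l, (l < k)%N -> Q p`_l.
  move=> pi; have /ex_minnP[k /asboolP pk kmin] : exists k, `[< ~ Q p`_k >].
    by exists i; apply/asboolP.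
  exists k => // l lt_lk; apply: contrapT => /asboolP/kmin.
  by rewrite leqNgt lt_lk.
have [i xi xmin] := minidx _ _ xi0; have [j yj ymin] := minidx _ _ yj0.
suff: Q (x`_i * y`_j) by move=> /Qp[].
have /= := Qxy (i + j)%N; rewrite coefM.
have ilt : (i < (i + j).+1)%N by rewrite ltnS leq_addr.
rewrite (bigD1 (Ordinal ilt)) //= addKn => Qs.
set r := \sum_(_ < _ | _) _ in Qs.
have -> : x`_i * y`_j = (x`_i * y`_j + r) + (-1) * r by rewrite mulN1r addrK.
apply: (QD) => //; apply: (QM); apply: Qsum => k ki.
(* Every other summand has a factor of index below [i] in [x] or below [j] in [y]. *)
have [lt_ki|lt_ik|eq_ki] := ltngtP k i.
- by rewrite mulrC; apply: (QM); apply: xmin.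
- apply: (QM); apply: ymin; by rewrite ltn_subLR ?ltn_add2r // -ltnS.
- by case/eqP: ki; apply: val_inj.
Qed.

(* Where an entry of g is a unit modulo Q and all entries before it lie in Q,
   the Toeplitz matrix of multiplication by g is triangular modulo Q, with a
   unit diagonal, so that its determinant is the required multiplier d. *)
Lemma content_cancel Q E g f : prime_ideal Q -> submodule iK E ->
  ~ coefsin Q g -> (forall i, E (map_poly iK g * f)`_i) ->
  exists2 d, ~ Q d & forall i, E (iK d * f`_i).
Proof.
move=> [[Q0 QD QM] Q1 Qp] sE /existsNP[j0 gj0] Egf; have [E0 _ EM] := sE.
have /ex_minnP[j /asboolP gj jmin] : exists k, `[< ~ Q g`_k >].
  by exists j0; apply/asboolP.
have {}jmin l : (l < j)%N -> Q g`_l.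
  by move=> lt_lj; apply: contrapT => /asboolP/jmin; rewrite leqNgt lt_lj.
pose n := size f.
pose M : 'M[D]_n := \matrix_(i, k) (if (k <= i + j)%N then g`_(i + j - k) else 0).
exists (\det M) => [Qdet|i].
  (* A permutation with s(k) <= k for all k is the identity, by comparing sums. Any other one
     therefore picks an entry above the diagonal, which is in [Q], and only the diagonal term of the
     determinant survives modulo [Q]. *)
  have perm_gt : forall s : {perm 'I_n}, s != 1%g -> exists i : 'I_n, (i < s i)%N.
    move=> s s1; apply: contrapT => /forallNP le.
    have {}le (k : 'I_n) : (s k <= k)%N by rewrite leqNgt; apply/negP/le.
    have [_] := leqif_sum (fun (i : 'I_n) (_ : xpredT i) => leqif_eq (le i)).
    rewrite [X in _ == X](reindex_inj (@perm_inj _ s)) eqxx => /esym/forallP si.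
    case/eqP: s1; apply/permP => i; apply: val_inj; rewrite perm1; exact/eqP/si.
  have Qterm (s : {perm 'I_n}) : s != 1%g -> Q ((-1) ^+ s * \prod_i M i (s i)).
    move=> /perm_gt[i lt_i]; apply: (QM); rewrite (bigD1 i) //= mulrC.
    apply: (QM); rewrite mxE; case: leqP => // le; apply: jmin.
    by rewrite ltn_subLR // ltn_add2r.
  have : Q (\prod_i M i i).
    have -> : \prod_i M i i = \det M + (-1) *
        \sum_(s : {perm 'I_n} | s != 1%g) (-1) ^+ s * \prod_i M i (s i).
      rewrite mulN1r [\det M](bigD1 1%g) //= odd_perm1 expr0 mul1r addrK.
      by apply: eq_bigr => i _; rewrite perm1.
    by apply: (QD) => //; apply: (QM); elim/big_ind: _.
  under eq_bigr do rewrite mxE leq_addr addKn.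
  by elim/big_ind: _ => // x y nx ny /Qp[].
have [lt_in|le_i] := ltnP i n; last by rewrite nth_default // mulr0.
pose F : 'cV[K]_n := \col_k f`_k.
have MF k : (map_mx iK M *m F) k 0 = (map_poly iK g * f)`_(k + j).
  (* The matrix product sums over the coefficients of [f], the polynomial product over indices up to
     [k + j]. Both are padded to the common length [N], as [c] vanishes beyond either bound. *)
  rewrite mxE coefMr; pose N := (n + (k + j).+1)%N.
  pose c l := if (l <= k + j)%N then (g`_(k + j - l))%:F * f`_l else 0.
  have widen m : (m <= N)%N -> (forall l, (m <= l)%N -> c l = 0) ->
      \sum_(l < m) c l = \sum_(l < N) c l.
    move=> le_mN c0; rewrite (big_ord_widen N c) // big_mkcond /=.
    by apply: eq_bigr => l _; case: ltnP => // /c0.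
  transitivity (\sum_(l < n) c l).
    apply: eq_bigr => l _; rewrite !mxE /c.
    by case: leqP => // _; rewrite rmorph0 mul0r.
  transitivity (\sum_(l < (k + j).+1) c l).
    rewrite !widen ?leq_addr ?leq_addl // => l le_l; rewrite /c; last first.
      by rewrite (nth_default 0 le_l) mulr0 if_same.
    by rewrite leqNgt le_l.
  by apply: eq_bigr => l _; rewrite /c -ltnS ltn_ord coef_map.
(* Cramer's rule: the adjugate expresses det M times each coefficient of [f] as a D-combination of
   coefficients of the product, which are in [E]. *)
have -> : iK (\det M) * f`_i =
    (map_mx iK (\adj M) *m (map_mx iK M *m F)) (Ordinal lt_in) 0.
  by rewrite mulmxA -map_mxM mul_adj_mx map_scalar_mx mul_scalar_mx !mxE.
rewrite mxE; apply: (submodule_sum _ sE) => k _.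
by rewrite mxE MF; apply: EM.
Qed.

End PolynomialModules.

(** * The three operations on D[X] *)

Section Operations.

Variable D : idomainType.

Local Notation K := {fraction D}.
Local Notation KX := {fraction {poly {fraction D}}}.
Local Notation iK := (@tofrac D).
Local Notation iX := (@polyfrac D).
Local Notation coefsin Q := [set p : {poly D} | forall i, Q p`_i].

Variable star : set K -> set K.
Hypothesis hstar : semistar iK star.
Hypothesis QMaxf_ex : exists Q, QMaxf star Q.

Implicit Types (E : set K) (A : set KX) (I Q : set D) (J : set {poly D}).
Implicit Types (f : {poly K}) (g : {poly D}).

Let QMaxf_prime Q : QMaxf star Q -> prime_ideal Q.
Proof. exact: (QMax_prime (@tofrac_inj D) hstar). Qed.

(** * The operations as meets of localizations *)

Definition locs : set (set D) := [set ~` Q | Q in QMaxf star].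
Definition bracket_locs : set (set {poly D}) :=
  [set (@polyC D) @` (~` Q) | Q in QMaxf star].
Definition paren_locs : set (set {poly D}) :=
  [set ~` coefsin Q | Q in QMaxf star].
(** K[X] is the localization of D[X] at the nonzero constants, so intersecting with A K[X] adds this
    one set. *)
Definition angle_locs : set (set {poly D}) :=
  paren_locs `|` [set (@polyC D) @` [set d | d != 0]].

Lemma multiplicative_polyC (S : set D) :
  multiplicative S -> multiplicative ((@polyC D) @` S).
Proof.
move=> [S1 S0 SM]; split; first by exists 1.
  by move=> [d Sd /eqP]; rewrite polyC_eq0 => /eqP d0; apply: S0; rewrite -d0.
by move=> _ _ [d Sd <-] [e Se <-]; exists (d * e); [apply: SM|rewrite polyCM].
Qed.

Lemma multiplicative_neq0 : multiplicative [set d : D | d != 0].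
Proof.
split=> /= [||x y x0 y0]; [exact: oner_neq0|by rewrite eqxx|exact: mulf_neq0].
Qed.

Lemma locs_multiplicative S : locs S -> multiplicative S.
Proof. by move=> [Q /QMaxf_prime/prime_multiplicative ? <-]. Qed.

Lemma bracket_locs_multiplicative S : bracket_locs S -> multiplicative S.
Proof.
by move=> [Q /QMaxf_prime/prime_multiplicative ? <-]; apply: multiplicative_polyC.
Qed.

Lemma paren_locs_multiplicative S : paren_locs S -> multiplicative S.
Proof. by move=> [Q /QMaxf_prime/prime_coefsin/prime_multiplicative ? <-]. Qed.

Lemma angle_locs_multiplicative S : angle_locs S -> multiplicative S.
Proof.
move=> [/paren_locs_multiplicative//|->].
exact/multiplicative_polyC/multiplicative_neq0.
Qed.

(** The base ring is left arbitrary because both D and D[X] are needed. *)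
Lemma bigcap_meet_loc (R : idomainType) (L : fieldType) (iota : {rmorphism R -> L})
    (B : set D -> set L) (S : set D -> set R) (E : set L) :
  (forall Q, QMaxf star Q ->
     prodm E (B Q) = [set z | exists2 t, S Q t & E (iota t * z)]) ->
  \bigcap_(Q in QMaxf star) prodm E (B Q) =
  meet_loc iota [set S Q | Q in QMaxf star] E.
Proof.
move=> EB; apply/seteqP; split=> [z Bz _ [Q mQ <-]|z Sz Q mQ].
  by have := Bz Q mQ; rewrite EB.
by rewrite EB //; apply: Sz; exists Q.
Qed.

Lemma tildeE E : submodule iK E -> star_tilde iK star E = meet_loc iK locs E.
Proof.
move=> sE; apply: (bigcap_meet_loc (S := fun Q => ~` Q)) => Q mQ.
by apply: prodm_loc => //; [apply: tofrac_inj|apply/prime_multiplicative/QMaxf_prime].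
Qed.

Lemma range_tofrac_Fbar : Fbar iK (range iK).
Proof.
split; last by exists 1; [exists 1; rewrite ?rmorph1|rewrite oner_eq0].
split; first by exists 0; rewrite ?rmorph0.
  by move=> _ _ [a _ <-] [b _ <-]; exists (a + b); rewrite ?rmorphD.
by move=> a _ [b _ <-]; exists (a * b); rewrite ?rmorphM.
Qed.

Lemma locD_submodule Q : prime_ideal Q -> submodule iK (locD Q).
Proof.
move=> /prime_multiplicative[Q1 Q0 QM].
have nz s : ~ Q s -> s%:F != 0 :> K.
  by move=> Qs; rewrite tofrac_eq0; apply/eqP => s0; apply: Q0; rewrite -s0.
split; first by exists 0, 1; rewrite rmorph0 mul0r.
  move=> _ _ [a [s [Qs ->]]] [b [t [Qt ->]]]; exists (a * t + b * s), (s * t).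
  split; first exact: QM.
  by rewrite rmorphD !rmorphM addf_div ?nz.
by move=> c _ [a [s [Qs ->]]]; exists (c * a), s; rewrite rmorphM mulrA.
Qed.

Lemma locD_frac Q a s : ~ Q s -> locD Q (a%:F / s%:F).
Proof. by move=> Qs; exists a, s. Qed.

Lemma sub_locD Q a : prime_ideal Q -> locD Q a%:F.
Proof. by move=> [_ Q1 _]; exists a, 1; rewrite rmorph1 divr1. Qed.

Lemma locDM Q x y : prime_ideal Q -> locD Q x -> locD Q y -> locD Q (x * y).
Proof.
move=> /prime_multiplicative[_ _ QM] [a [s [Qs ->]]] [b [t [Qt ->]]].
by exists (a * b), (s * t); split; [apply: QM|rewrite !rmorphM mulf_div].
Qed.

Lemma locD_clear Q f : prime_ideal Q -> (forall i, locD Q f`_i) ->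
  exists2 d, ~ Q d & exists g, iK d *: f = map_poly iK g.
Proof.
move=> pQ Qf; have mQ := prime_multiplicative pQ; have [_ Q0 _] := mQ.
have [sub1 _] := range_tofrac_Fbar.
have [|d Qd df] := common_multiplier (f := f) mQ sub1.
  move=> i; have [a [s [Qs ->]]] := Qf i; exists s => //; exists a => //.
  rewrite mulrC divfK // tofrac_eq0; apply/eqP => s0; apply: Qs.
  by rewrite s0; case: pQ => -[].
by exists d => //; apply: map_poly_lift => i; rewrite coefZ.
Qed.

(** Denominators in T[X] can be taken constant. The two uses are T = D_Q with the complement of Q,
    and T = K with the nonzero constants. *)
Lemma prodm_polysE (T : set K) (S : set D) A : multiplicative S ->
  submodule iX A -> (forall s, S s -> T (s%:F)^-1) -> T 0 ->
  (forall f, (forall i, T f`_i) ->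
     exists2 d, S d & exists g, iK d *: f = map_poly iK g) ->
  prodm A (polys T) = [set z | exists2 t, ((@polyC D) @` S) t & A (iX t * z)].
Proof.
move=> mS sA TV T0 TS; apply: prodm_locE => //; first exact: multiplicative_polyC.
  move=> _ [s Ss <-]; have s0 : s != 0.
    by apply/eqP => s0; case: mS => _ /(_ _)[]; rewrite -s0.
  split; last by rewrite -(rmorph0 iX) (inj_eq (@polyfrac_inj D)) polyC_eq0.
  have -> : (iX s%:P)^-1 = constfrac (s%:F)^-1.
    by rewrite polyfracC -(fmorphV (@tofrac {poly K} \o polyC)).
  by apply/polysE => i; rewrite coefC; case: eqP => _ //; apply: TV.
move=> _ [f Tf <-]; have [d Sd [g dg]] := TS _ Tf.
by exists d%:P; [exists d|exists g => //; rewrite polyfracCM dg].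
Qed.

Lemma bracketE A : submodule iX A -> bracket_op star A = meet_loc iX bracket_locs A.
Proof.
move=> sA; apply: (bigcap_meet_loc (S := fun Q => (@polyC D) @` (~` Q))) => Q mQ.
have pQ := QMaxf_prime mQ; have mS := prime_multiplicative pQ.
apply: prodm_polysE => // [s Qs||f]; last exact: locD_clear.
  by exists 1, s; rewrite rmorph1 mul1r.
by have [] := locD_submodule pQ.
Qed.

Lemma locD_lift Q g : prime_ideal Q -> forall i, locD Q (map_poly iK g)`_i.
Proof. by move=> pQ i; rewrite coef_map; apply: sub_locD. Qed.

(** A coefficient of [g] outside [Q] is a unit of D_Q. *)
Lemma content_locD Q g : prime_ideal Q -> ~ coefsin Q g ->
  content (locD Q) (map_poly iK g) = locD Q.
Proof.
move=> pQ /existsNP[i gi]; have [L0 LD _] := locD_submodule pQ.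
apply/seteqP; split=> [|z Lz].
  by apply: prodm_min => // a _ La [k _ <-]; apply: locDM => //; apply: locD_lift.
have g0 : (g`_i)%:F != 0 :> K.
  by rewrite tofrac_eq0; apply/eqP => g0; apply: gi; rewrite g0; case: pQ => -[].
have -> : z = z / (g`_i)%:F * (map_poly iK g)`_i by rewrite coef_map divfK.
apply: prodm_mul; last by exists i.
by apply: locDM => //; rewrite -[_^-1]mul1r -(rmorph1 iK); apply: locD_frac.
Qed.

Lemma coefsinN_neq0 Q g : prime_ideal Q -> ~ coefsin Q g -> iX g != 0.
Proof.
move=> [[Q0 _ _] _ _] Qg; rewrite -(rmorph0 iX) (inj_eq (@polyfrac_inj D)).
by apply/eqP => g0; apply: Qg => i; rewrite g0 coef0.
Qed.

Lemma mulr_frac (F : fieldType) (a b c : F) : c != 0 -> a * b = a * c * (b / c).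
Proof. by move=> c0; rewrite -mulrA [c * _]mulrC divfK. Qed.

(** The point is that A D_Q(X) is the localization of A at the polynomials outside Q[X]. Such
    polynomials have unit content over D_Q; conversely, a denominator of unit content, once cleared
    to D[X] by a constant outside [Q], stays outside Q[X]. *)
Lemma parenE A : submodule iX A -> paren_op star A = meet_loc iX paren_locs A.
Proof.
move=> sA; apply: (bigcap_meet_loc (S := fun Q => ~` coefsin Q)) => Q mQ.
have pQ := QMaxf_prime mQ; have [[Q0 QD QM] Q1 Qp] := pQ.
have [_ L0 LM] := prime_multiplicative pQ.
apply: prodm_locE => //; first exact/prime_multiplicative/prime_coefsin.
  move=> g Qg; split; last exact: coefsinN_neq0 Qg.
  exists 1, (map_poly iK g); split; last by rewrite rmorph1 mul1r.
  - by move=> i; rewrite -(rmorph1 (map_poly iK)); apply: locD_lift.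
  - exact: locD_lift.
  - exact: content_locD.
move=> _ [f [h [Lf Lh ch ->]]].
have [d Qd [p dp]] := locD_clear pQ Lf; have [e Qe [q eq]] := locD_clear pQ Lh.
have nz s : ~ Q s -> s%:F != 0 :> K.
  by move=> Qs; rewrite tofrac_eq0; apply/eqP => s0; apply: Qs; rewrite s0.
have Qq : ~ coefsin Q q.
  (* [N] is the maximal ideal Q D_Q. If [q], which is [e] times [h], were in Q[X], then [e] times
     the content of [h] would lie in [N]; as that content is D_Q, this would put [e] in [Q]. *)
  move=> Qq; pose N := [set z : K | exists a s, [/\ Q a, ~ Q s & z = a%:F / s%:F]].
  have : content (locD Q) h `<=` [set z | N (e%:F * z)].
    apply: prodm_min => /= [|x y|x _ [a [s [Qs ->]]] [i _ <-]].
    - by exists 0, 1; split=> //; rewrite mulr0 rmorph0 mul0r.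
    - move=> [a [s [Qa Qs ax]]] [b [t [Qb Qt bt]]].
      exists (a * t + b * s), (s * t); split; last 2 first.
      + exact: LM.
      + by rewrite mulrDr ax bt rmorphD !rmorphM addf_div ?nz.
      + by apply: QD; rewrite mulrC; apply: QM.
    - exists (a * q`_i), s; split=> //; first by apply: QM.
      have qi : e%:F * h`_i = (q`_i)%:F by rewrite -coefZ eq coef_map.
      by rewrite tofracM -qi mulrCA -!mulrA; congr (_ * _); rewrite [LHS]mulrC -mulrA.
  rewrite ch => /(_ 1); rewrite -(rmorph1 iK) => /(_ (sub_locD _ pQ))[a [s [Qa Qs]]].
  rewrite rmorph1 mulr1 => ea; suff /Qp[] : Q (e * s) by [].
  have -> : e * s = a; last by [].
  by apply: (@tofrac_inj D); rewrite tofracM ea divfK ?nz.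
(* From p = d f and q = e h one gets f / h = (e p) / (d q). *)
exists (d%:P * q).
  have [_ _] := prime_multiplicative (prime_coefsin pQ); apply => //.
  by move=> /(_ 0%N); rewrite coefC.
exists (e%:P * p) => //.
have h0 : tofrac h != 0 :> KX.
  apply/eqP => h0; have /eqP := coefsinN_neq0 pQ Qq; apply.
  by rewrite /polyfrac /= -eq -mul_polyC tofracM h0 mulr0.
have lin (c : D) u r (v : {poly K}) : iK u *: v = map_poly iK r ->
    iX (c%:P * r) = constfrac (c * u)%:F * tofrac v.
  move=> uv; have cuv : map_poly iK (c *: r) = (c * u)%:F *: v.
    by rewrite map_polyZ -uv scalerA -rmorphM.
  by rewrite mul_polyC /polyfrac /= cuv -mul_polyC !tofracM.
rewrite /=; have -> : iX (e%:P * p) = constfrac (e * d)%:F * tofrac f by exact: lin.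
have -> : iX (d%:P * q) = constfrac (d * e)%:F * tofrac h by exact: lin.
by rewrite (mulrC e d); apply: mulr_frac.
Qed.

Lemma angleE A : submodule iX A -> angle_op star A = meet_loc iX angle_locs A.
Proof.
move=> sA; rewrite /angle_op parenE // (prodm_polysE multiplicative_neq0) //.
- apply/seteqP; split=> [z [pz [t St At]] S [/pz//|->]|z az]; first by exists t.
  by split=> [S pS|]; [apply: az; left|apply: az; right].
- by move=> f _; have [d [g [d0 dg]]] := clear_denom f; exists d => //; exists g.
Qed.

(** A constant outside [Q] is a polynomial outside Q[X], and it is also a nonzero constant; the
    latter covers the extra set, given one [Q]. *)
Lemma bracket_sub_angle A : meet_loc iX bracket_locs A `<=` meet_loc iX angle_locs A.
Proof.
move=> z bz S; have bQ Q : QMaxf star Q -> exists2 d, ~ Q d & A (iX d%:P * z).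
  move=> mQ; have [|_ [d Qd <-] Ad] := bz ((@polyC D) @` (~` Q)); first by exists Q.
  by exists d.
move=> [[Q mQ <-]|->].
  have [d Qd Ad] := bQ Q mQ; exists d%:P => //.
  by move=> /(_ 0%N); rewrite coefC.
have [Q mQ] := QMaxf_ex; have [d Qd Ad] := bQ Q mQ; exists d%:P => //.
exists d => //=; apply/eqP => d0; apply: Qd; rewrite d0.
by have [[]] := QMaxf_prime mQ.
Qed.

(** * Compactness of the three families, and the set N^star *)

Lemma bracket_locs_compact : compact_family bracket_locs.
Proof.
move=> J [J0 JD JM] bJ.
have JQ Q : QMaxf star Q -> exists2 d, ~ Q d & J d%:P.
  move=> mQ; have [|_ [d Qd <-] Jd] := bJ ((@polyC D) @` (~` Q)); first by exists Q.
  by exists d.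
(* The constants in [J] form an ideal of D contained in no [Q], to which the compactness over D
   applies. *)
have [s sJ sQ] : exists2 s : seq D, {in s, forall r, J r%:P}
    & forall Q, QMaxf star Q -> exists2 r, r \in s & ~ Q r.
  apply: (QMax_compact (@tofrac_inj D) hstar (I := [set d | J d%:P])).
  - split=> [|x y Jx Jy|a x Jx] /=; rewrite ?polyC0 ?polyCD ?polyCM //.
      exact: JD.
    exact: JM.
  - have [Q mQ] := QMaxf_ex; have [d Qd Jd] := JQ _ mQ; exists d => //.
    by apply/eqP => d0; apply: Qd; rewrite d0; have [[]] := QMaxf_prime mQ.
  - by move=> Q mQ sub; have [d Qd /sub] := JQ _ mQ.
exists (map polyC s); first by move=> _ /mapP[r rs ->]; apply: sJ.
move=> _ [Q mQ <-]; have [r rs Qr] := sQ Q mQ.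
by exists r%:P; [exists r|apply: map_f].
Qed.

(* The coefficients of the elements of an ideal of D[X] form an ideal of D, and
   finitely many of them occur in a single element, because the exponents of
   its summands may be shifted apart by powers of X. *)
Lemma ideal_avoids_coefsin J : ideal J -> meets paren_locs J ->
  exists2 g, J g & forall Q, QMaxf star Q -> ~ coefsin Q g.
Proof.
move=> [J0 JD JM] pJ.
pose I := [set c | exists2 g, J g & exists k, c = g`_k].
have JQ Q : QMaxf star Q -> exists2 d, ~ Q d & I d.
  move=> mQ; have [|g /existsNP[k gk] Jg] := pJ (~` coefsin Q); first by exists Q.
  by exists g`_k => //; exists g => //; exists k.
have [s sI sQ] : exists2 s : seq D, {in s, forall r, I r}
    & forall Q, QMaxf star Q -> exists2 r, r \in s & ~ Q r.
  apply: (QMax_compact (@tofrac_inj D) hstar (I := I)).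
  - split; first by exists 0 => //; exists 0%N; rewrite coef0.
      (* The shifts bring the two chosen coefficients to the same index [k + l], where they add
         up. *)
      move=> _ _ [g Jg [k ->]] [h Jh [l ->]]; exists ('X^l * g + 'X^k * h).
        by apply: JD; apply: JM.
      exists (k + l)%N; rewrite coefD !coefXnM addnK addKn.
      by rewrite !ltnNge leq_addl leq_addr.
    move=> a _ [g Jg [k ->]]; exists (a%:P * g); first exact: JM.
    by exists k; rewrite coefCM.
  - have [Q mQ] := QMaxf_ex; have [d Qd Id] := JQ _ mQ; exists d => //.
    by apply/eqP => d0; apply: Qd; rewrite d0; have [[]] := QMaxf_prime mQ.
  - by move=> Q mQ sub; have [d Qd /sub] := JQ _ mQ.
have [g Jg gs] : exists2 g, J g & {in s, forall c, exists k, c = g`_k}.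
  elim: s sI {sQ} => [_|c s IH sI]; first by exists 0.
  have [|g Jg gs] := IH; first by move=> r rs; apply: sI; rewrite inE rs orbT.
  have [h Jh [k hk]] : I c by apply: sI; rewrite inE eqxx.
  (* Shifting by [size g] keeps the coefficients of [g] and [h] from overlapping. *)
  exists (g + 'X^(size g) * h); first by apply: JD => //; apply: JM.
  move=> r; rewrite inE => /orP[/eqP->|/gs[l ->]].
    exists (k + size g)%N; rewrite coefD coefXnM addnK ltnNge leq_addl /=.
    by rewrite nth_default ?leq_addl // add0r.
  have [lt_l|le_l] := ltnP l (size g).
    by exists l; rewrite coefD coefXnM lt_l addr0.
  (* Here the recorded coefficient of [g] is the default 0, so any index past the end of the new
     polynomial will do. *)
  exists (size (g + 'X^(size g) * h)).
  by rewrite [RHS]nth_default // nth_default.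
exists g => // Q mQ Qg; have [c /gs[k ->]] := sQ Q mQ; exact.
Qed.

Lemma paren_locs_compact : compact_family paren_locs.
Proof.
move=> J iJ /(ideal_avoids_coefsin iJ)[g Jg gQ].
exists [:: g]; first by move=> r; rewrite inE => /eqP->.
by move=> _ [Q mQ <-]; exists g; [apply: gQ|rewrite /= inE].
Qed.

Lemma angle_locs_compact : compact_family angle_locs.
Proof.
move=> J iJ aJ; have [|g Jg gQ] := ideal_avoids_coefsin iJ.
  by move=> S pS; apply: aJ; left.
have [|t St Jt] := aJ ((@polyC D) @` [set d | d != 0]); first by right.
exists [:: g; t]; first by move=> r; rewrite !inE => /orP[]/eqP->.
move=> _ [[Q mQ <-]|->]; last by exists t; rewrite //= !inE eqxx orbT.
by exists g; [apply: gQ|rewrite /= !inE eqxx].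
Qed.

(** The content of [g] is finitely generated, so its [star] can be tested through [star_f]: it
    equals the [star] of D exactly when it contains 1, that is, when no maximal quasi-ideal contains
    all coefficients. *)
Lemma NstarE g : Nstar star g <-> forall Q, QMaxf star Q -> ~ coefsin Q g.
Proof.
rewrite /Nstar /=; set gK := map_poly iK g.
have csub : content (range iK) gK = prodm (range iK) [set` (gK : seq K)].
  apply/seteqP; split; last first.
    by apply: prodm_mono => // x /= /(nthP 0)[i lt_i <-]; exists i.
  apply: prodm_sub; first exact: prodm_submodule.
  move=> _ [i _ <-]; have [lt_i|le_i] := ltnP i (size gK).
    by apply: sub_prodm; rewrite /= mem_nth.
  by rewrite nth_default //; apply: prodm0.
have nz : g != 0 -> exists2 x, x \in (gK : seq K) & x != 0.
  move=> g0; have gK0 : gK != 0.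
    by rewrite map_poly_eq0_id0 // ?tofrac_eq0 lead_coef_eq0.
  exists (lead_coef gK); last by rewrite lead_coef_eq0.
  by rewrite mem_nth // prednK // size_poly_gt0.
have D1 := range_tofrac_Fbar.
rewrite csub; split=> [[g0 gD] Q mQ Qg|gQ].
  apply: (star_f1N mQ (@subset_refl _ Q)).
  apply/star_fP; first by apply: ideal_image; case: (mQ) => -[].
  exists gK; split; [|exact: nz|].
    by move=> _ /= /(nthP 0)[i _ <-]; rewrite coef_map; exists g`_i.
  rewrite gD; apply: (semistar_ext hstar D1).
  by exists 1; rewrite ?rmorph1.
have g0 : g != 0.
  have [Q mQ] := QMaxf_ex; apply/eqP => g0; apply: (gQ Q mQ) => i /=.
  by rewrite g0 coef0; have [[]] := QMaxf_prime mQ.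
split=> //; have bg := Fbar_gen iK (nz g0).
have gD : prodm (range iK) [set` (gK : seq K)] `<=` range iK.
  apply: prodm_sub; first by case: D1.
  by move=> _ /= /(nthP 0)[i _ <-]; rewrite coef_map; exists g`_i.
have bs := semistar_Fbar hstar bg; have [ss _] := bs.
apply/seteqP; split; first exact: (semistar_mono hstar).
rewrite -[X in _ `<=` X](semistar_idem hstar bg); apply: (semistar_mono hstar) => //.
suff s1 : star (prodm (range iK) [set` (gK : seq K)]) 1.
  by move=> _ [a _ <-]; rewrite -[iK a]mulr1; case: ss => _ _; apply.
(* The content lives in K, whereas [star_f1] speaks of ideals of D; [I] is the content pulled back
   to D, with nothing lost since [g] has coefficients in D. *)
pose I := iK @^-1` prodm (range iK) [set` (gK : seq K)].
have II : iK @` I = prodm (range iK) [set` (gK : seq K)].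
  apply/seteqP; split=> [_ [a Ia <-]//|x gx].
  by have [a _ ax] := gD _ gx; exists a => //; rewrite /I /= ax.
have Ic i : I g`_i.
  rewrite /I /= -csub; apply: sub_prodm; exists i => //.
  by rewrite coef_map.
have : star_f iK star (iK @` I) 1.
  apply: (star_f1 (@tofrac_inj D) hstar).
  - have [P0 PD PM] := prodm_submodule iK [set` (gK : seq K)].
    rewrite /I; split=> [|x y|a x] /=; rewrite ?rmorph0 ?rmorphD ?rmorphM //.
      exact: PD.
    exact: PM.
  - exists (lead_coef g); last by rewrite lead_coef_eq0.
    exact: Ic.
  - by move=> Q mQ IQ; apply: (gQ Q mQ) => i; apply: IQ.
rewrite II => -[F [[bF _] Fg] F1].
by apply: (semistar_mono hstar bF bg) F1.
Qed.

Lemma Nstar_multiplicative : multiplicative (Nstar star).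
Proof.
have mul Q : QMaxf star Q -> multiplicative (~` coefsin Q).
  by move=> /QMaxf_prime/prime_coefsin/prime_multiplicative.
split.
- by apply/NstarE => Q /mul[].
- by move=> [/eqP].
- move=> x y /NstarE xN /NstarE yN; apply/NstarE => Q mQ.
  by have [_ _ QM] := mul Q mQ; apply: QM; [apply: xN|apply: yN].
Qed.

(** Each maximal quasi-ideal is one of the primes whose extension misses [Nstar star], so an element
    of the [sharp] set avoids every Q[X]. *)
Lemma Nstar_extended_saturated : extended_saturated (Nstar star).
Proof.
split; first exact: Nstar_multiplicative.
apply/seteqP; split=> [g gN [P [_ PN] gP]|g gS].
  by move: PN => /seteqP[PN _]; apply: (PN g).
apply/NstarE => Q mQ Qg; apply: gS; exists Q => //; split; first exact: QMaxf_prime.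
by apply/seteqP; split=> // h [Qh /NstarE/(_ Q mQ)].
Qed.

(** The conductor of [z] into [A] contains a single polynomial outside every Q[X], so one
    denominator serves all [Q] at once. *)
Lemma paren_circledast A : submodule iX A ->
  paren_op star A = circledast iX (Nstar star) A.
Proof.
move=> sA; rewrite parenE // /circledast prodm_loc //; last 2 first.
- exact: polyfrac_inj.
- exact: Nstar_multiplicative.
apply/seteqP; split=> [z pz|z [g /NstarE gN Ag] _ [Q mQ <-]].
  have [g Ag gQ] := ideal_avoids_coefsin (submodule_colon z sA) pz.
  by exists g => //; apply/NstarE.
by exists g => //; apply: gN.
Qed.

(** * Extension and strict extension *)

Lemma tilde_submodule E : submodule iK E -> submodule iK (star_tilde iK star E).
Proof.
move=> sE; rewrite tildeE //; apply: meet_loc_submodule => //.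
exact: locs_multiplicative.
Qed.

Lemma extX_tilde_sub_bracket E : submodule iK E ->
  extX (star_tilde iK star E) `<=` meet_loc iX bracket_locs (polys E).
Proof.
move=> sE; have sT := tilde_submodule sE; rewrite extXE // => _ [f Ef <-] _ [Q mQ <-].
have mS := prime_multiplicative (QMaxf_prime mQ).
have [i|d Qd Ed] := common_multiplier (f := f) mS sE.
  by have := Ef i; rewrite tildeE //; apply; exists Q.
by exists d%:P; [exists d|rewrite polyfracCM; apply/polysE => i; rewrite coefZ].
Qed.

(** The nonzero constants among the sets force [z] to be a polynomial over K; [content_cancel] then
    trades each polynomial multiplier for a constant one outside [Q]. *)
Lemma angle_sub_extX_tilde E : submodule iK E ->
  meet_loc iX angle_locs (polys E) `<=` extX (star_tilde iK star E).
Proof.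
move=> sE z az; rewrite extXE; last exact: tilde_submodule.
have [|_ [d d0 <-] [h Eh hz]] := az ((@polyC D) @` [set d | d != 0]); first by right.
have dF : d%:F != 0 :> K by rewrite tofrac_eq0.
have zf : z = tofrac ((d%:F)^-1 *: h).
  rewrite -mul_polyC tofracM hz /= polyfracC mulrA -tofracM -polyCM mulVf //.
  by rewrite polyC1 tofrac1 mul1r.
move: az; rewrite zf; set f := _ *: h => af; apply/polysE => i.
rewrite tildeE // => _ [Q mQ <-].
have [|g Qg] := af (~` coefsin Q); first by left; exists Q.
rewrite polyfracM => /polysE Egf.
by have [e Qe Ee] := content_cancel (QMaxf_prime mQ) sE Qg Egf; exists e.
Qed.

(** The inclusions from the extended closure to the bracket operation, on to the angle operation and
    back form a cycle, which yields strictness for both. *)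
Lemma bracket_strict : is_strict_extension (star_tilde iK star) (bracket_op star).
Proof.
move=> E [sE _]; rewrite [extX E]extXE // bracketE; last exact: polys_submodule.
apply/seteqP; split; first exact: extX_tilde_sub_bracket.
exact: subset_trans (@bracket_sub_angle _) (angle_sub_extX_tilde sE).
Qed.

Lemma angle_strict : is_strict_extension (star_tilde iK star) (angle_op star).
Proof.
move=> E [sE _]; rewrite [extX E]extXE // angleE; last exact: polys_submodule.
apply/seteqP; split; last exact: angle_sub_extX_tilde.
exact: subset_trans (extX_tilde_sub_bracket sE) (@bracket_sub_angle _).
Qed.

Lemma strict_extension (o : set KX -> set KX) :
  is_strict_extension (star_tilde iK star) o -> is_extension (star_tilde iK star) o.
Proof.
move=> so E bE; have [sE _] := bE; have sT := tilde_submodule sE.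
rewrite -so // extXE //; apply/seteqP; split=> z /=; by rewrite (polys_constE _ sT).
Qed.

Lemma paren_extension : is_extension (star_tilde iK star) (paren_op star).
Proof.
move=> E [sE _]; rewrite extXE // parenE; last exact: polys_submodule.
rewrite tildeE //; apply/seteqP; split=> z Ez _ [Q mQ <-].
  have [|d Qd Ed] := Ez (~` Q); first by exists Q.
  exists d%:P; first by move=> /(_ 0%N); rewrite coefC.
  rewrite /= polyfracC /constfrac /= -tofracM -polyCM.
  exact/polys_constE.
(* As [z] is constant, a coefficient of [g] outside [Q] is itself a multiplier. *)
have [|g /existsNP[i gi]] := Ez (~` coefsin Q); first by exists Q.
rewrite polyfracM => /polysE/(_ i); rewrite coefMC coef_map => Eg.
by exists g`_i.
Qed.

(** * Separation of the operations and uniqueness *)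

Lemma bracket_neq_angle : ~ op_eq iX (bracket_op star) (angle_op star).
Proof.
have [Q mQ] := QMaxf_ex; have pQ := QMaxf_prime mQ.
have [q Qq q0] : exists2 q, Q q & q != 0 by case: mQ => -[].
have [[Q0 QD QM] Q1 _] := pQ.
(* This is the ideal (q, X), described by its constant coefficients. It contains X, which is outside
   every P[X], and the nonzero constant [q], so its angle closure contains 1; but all its constants
   lie in [Q]. *)
pose J := [set p : {poly D} | exists a, p`_0 = a * q].
have iJ : ideal J.
  split; first by exists 0; rewrite coef0 mul0r.
    by move=> x y [a xa] [b yb]; exists (a + b); rewrite coefD xa yb mulrDl.
  by move=> c x [a xa]; exists (c`_0 * a); rewrite coefM big_ord1 xa mulrA.
have JX : J 'X by exists 0; rewrite coefX mul0r.
have sJ := ideal_image iX iJ.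
have bJ : Fbar iX (iX @` J).
  apply: Fbar_image => //; first exact: polyfrac_inj.
  by exists 'X; rewrite ?polyX_eq0.
have a1 : meet_loc iX angle_locs (iX @` J) 1.
  move=> _ [[P mP <-]|->]; last first.
    exists q%:P; first by exists q.
    by rewrite mulr1; exists q%:P => //; exists 1; rewrite coefC mul1r.
  exists 'X; last by rewrite mulr1; exists 'X.
  by move=> /(_ 1%N); rewrite coefX; have [_ P1 _] := QMaxf_prime mP.
move=> /(_ _ bJ); rewrite bracketE // angleE // => eqJ; move: a1.
rewrite -eqJ => /(_ ((@polyC D) @` (~` Q)))[|_ [d Qd <-] [p [a pa]]].
  by exists Q.
rewrite mulr1 => /polyfrac_inj pd; apply: Qd.
by move: pa; rewrite pd coefC /= => ->; apply: QM.
Qed.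

(* 1/X lies in the Nagata ring of every D_Q, but it is not a polynomial. *)
Lemma strict_extension_not_paren (o : set KX -> set KX) :
  is_strict_extension (star_tilde iK star) o ->
  ~ strict_equiv_over o (paren_op star).
Proof.
move=> so eqo; have bD := range_tofrac_Fbar; have [sD _] := bD.
have X0 : (tofrac 'X : KX) != 0 by rewrite tofrac_eq0 polyX_eq0.
have : paren_op star (extX (range iK)) (tofrac 'X)^-1.
  rewrite extXE // parenE; last exact: polys_submodule.
  move=> _ [Q mQ <-]; exists 'X.
    by move=> /(_ 1%N); rewrite coefX; have [_ Q1 _] := QMaxf_prime mQ.
  rewrite /= /polyfrac /= map_polyX divff // -tofrac1; apply/polysE => i.
  by rewrite coef1; exists (i == 0%N)%:R; rewrite ?rmorph_nat.
rewrite -eqo // -so // extXE; last exact: tilde_submodule.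
move=> [f _ fX]; have /(congr1 (fun p : {poly K} => p`_0)) : f * 'X = 1.
  by apply: tofrac_inj; rewrite tofracM fX mulVf // tofrac1.
by rewrite coefMX coef1 /= => /esym/eqP; rewrite oner_eq0.
Qed.

Lemma op_eq_strict_equiv (o1 o2 : set KX -> set KX) :
  op_eq iX o1 o2 -> strict_equiv_over o1 o2.
Proof. by move=> oE E /Fbar_extX/oE. Qed.

Lemma extended_saturated_unique (o : set KX -> set KX) (S : set {poly D}) :
  is_extension (star_tilde iK star) o -> extended_saturated S ->
  op_eq iX o (circledast iX S) -> S = Nstar star.
Proof.
move=> eo [mS SE] oS.
(* Both sides say that 1 lies in the closure of [I]: the left one computes it in D, the right one
   through I[X] and [S]. *)
have key I : ideal I -> (exists2 x, I x & x != 0) ->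
    (forall Q, QMaxf star Q -> exists2 d, ~ Q d & I d) <->
    exists2 t, S t & coefsin I t.
  move=> iI I0; have bI := Fbar_image (@tofrac_inj D) iI I0; have [sI _] := bI.
  have memI d : (iK @` I) d%:F <-> I d.
    by split=> [[e Ie /tofrac_inj<-]|] //; exists d.
  have := eo _ bI; rewrite oS; last exact: Fbar_extX.
  rewrite extXE // tildeE // /circledast prodm_loc //; last 2 first.
  - exact: polyfrac_inj.
  - exact: polys_submodule.
  move=> /seteqP[/(_ 1) tS /(_ 1) St].
  have one g : iX g * constfrac 1 = tofrac (map_poly iK g).
    by rewrite /constfrac /= polyfracM mulr1.
  split=> [IQ|[t tS' It] Q mQ].
    have [|t St' t1] := tS.
      move=> _ [Q mQ <-]; have [d Qd Id] := IQ Q mQ; exists d => //.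
      by rewrite mulr1; apply/memI.
    exists t => // i; apply/memI; move: t1; rewrite one => /polysE/(_ i).
    by rewrite coef_map.
  have tI : meet_loc iK locs (iK @` I) 1.
    apply: St; exists t => //; rewrite one; apply/polysE => i.
    by rewrite coef_map; apply/memI.
  have [|d Qd] := tI (~` Q); first by exists Q.
  by rewrite mulr1 => /memI Id; exists d.
(* With I = Q, an element of [S] in Q[X] would give an element of [Q] outside [Q]. *)
apply/seteqP; split=> [g Sg|g /NstarE gN].
  apply/NstarE => Q mQ Qg; have [[iQ Q0 _] _ _] := mQ.
  have /(key Q iQ Q0)/(_ Q mQ)[d] : exists2 t, S t & coefsin Q t by exists g.
  by [].
(* Saturation reduces the claim to excluding a prime [P] with [g] in P[X] and P[X] disjoint from
   [S]. Since [g] is outside every Q[X], no [Q] contains [P], and [key] yields an element of [S] in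
   P[X]. *)
rewrite SE => -[P [pP PS] Pg]; have [iP _ _] := pP.
have g0 : g != 0.
  have [Q mQ] := QMaxf_ex; apply/eqP => g0; apply: (gN Q mQ) => i /=.
  by rewrite g0 coef0; have [[]] := QMaxf_prime mQ.
have P0 : exists2 x, P x & x != 0.
  by exists (lead_coef g); rewrite ?lead_coef_eq0 //; apply: Pg.
have [t St Pt] : exists2 t, S t & coefsin P t.
  apply/(key P iP P0) => Q mQ; apply: contrapT => QP; apply: (gN Q mQ) => i.
  by apply: contrapT => Qg; apply: QP; exists g`_i => //; apply: Pg.
by move: PS => /seteqP[PS _]; apply: (PS t).
Qed.

End Operations.

Theorem corollary18 (D : idomainType)
    (star : set {fraction D} -> set {fraction D})
    (hstar : semistar (@tofrac D) star)
    (hQ : exists2 Q, QMaxf star Q & locD Q `<` setT) :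
  let tilde := star_tilde (@tofrac D) star in
  let br := bracket_op star in
  let an := angle_op star in
  let pa := paren_op star in
  let iX := @polyfrac D in
  (* (1) *)
  ([/\ [/\ semistar iX br, finite_type iX br, stable iX br
         & is_extension tilde br],
       [/\ semistar iX an, finite_type iX an, stable iX an
         & is_extension tilde an],
       [/\ semistar iX pa, finite_type iX pa, stable iX pa
         & is_extension tilde pa],
       is_strict_extension tilde br /\ is_strict_extension tilde an
     & [/\ ~ op_eq iX br an, ~ op_eq iX br pa & ~ op_eq iX an pa]]
   /\
   [/\ extended_saturated (Nstar star),
       op_eq iX pa (circledast iX (Nstar star))
     & forall o : set {fraction {poly {fraction D}}} ->
                  set {fraction {poly {fraction D}}},
         semistar iX o -> finite_type iX o -> stable iX o ->
         is_extension tilde o ->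
         (exists2 S : set {poly D}, extended_saturated S
            & op_eq iX o (circledast iX S)) ->
         op_eq iX o pa])
  /\
  (* (2) *)
  [/\ equiv_over br an, equiv_over an pa, strict_equiv_over br an,
      ~ strict_equiv_over br pa & ~ strict_equiv_over an pa].
Proof.
move=> tilde br an pa iX.
have QM : exists Q, QMaxf star Q by have [Q mQ _] := hQ; exists Q.
have sbr := bracket_strict hstar QM; have san := angle_strict hstar QM.
have ebr := strict_extension hstar sbr; have ean := strict_extension hstar san.
have epa := paren_extension hstar.
have nbr := strict_extension_not_paren hstar sbr.
have nan := strict_extension_not_paren hstar san.
have mbr := bracket_locs_multiplicative hstar.
have man := angle_locs_multiplicative hstar.
have mpa := paren_locs_multiplicative hstar.
have Ebr := bracketE hstar; have Ean := angleE hstar; have Epa := parenE hstar.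
split; split.
- split=> //.
  + split=> //; [exact: meet_loc_semistar Ebr| |exact: meet_loc_stable Ebr].
    exact: meet_loc_finite_type Ebr (bracket_locs_compact hstar QM).
  + split=> //; [exact: meet_loc_semistar Ean| |exact: meet_loc_stable Ean].
    exact: meet_loc_finite_type Ean (angle_locs_compact hstar QM).
  + split=> //; [exact: meet_loc_semistar Epa| |exact: meet_loc_stable Epa].
    exact: meet_loc_finite_type Epa (paren_locs_compact hstar QM).
  (* Equal operations would be strictly equivalent over D, which has been excluded for [pa]. *)
  + split; [exact: bracket_neq_angle| |].
      by move=> /op_eq_strict_equiv.
    by move=> /op_eq_strict_equiv.
- split; first exact: Nstar_extended_saturated.
    by move=> A [sA _]; apply: paren_circledast.
  (* The set [S] is forced to be [Nstar star], whose localization is [pa]. *)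
  move=> o _ _ _ eo [S eS oS] A bA; have [sA _] := bA.
  rewrite oS // (extended_saturated_unique hstar QM eo eS oS).
  by rewrite -paren_circledast.
- by move=> E bE; apply: etrans (esym (ebr E bE)) (ean E bE).
- by move=> E bE; apply: etrans (esym (ean E bE)) (epa E bE).
- by move=> E bE; apply: etrans (esym (sbr E bE)) (san E bE).
- exact: nbr.
- exact: nan.
Qed.
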